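(* For any $\beta>1$ and any integer $K\ge1$, there does not exist an algorithm that, for every $K$-parametric minimization problem (instance), computes a $\beta$-approximation set $S$ with $|S|<(K+1)\cdot|S^*|$, where $S^*$ denotes a $\beta$-approximation set of minimum cardinality, and that generates feasible solutions only by calling $\mathrm{ALG}_1$.
   Context: An instance of a (linear) $K$-parametric minimization problem is given by a nonempty set $X$ of feasible solutions, functions $a,b_1,\dots,b_K:X\to\mathbb{R}$ and a parameter set $\Lambda=\prod_{k=1}^K[\lambda^{\min}_k,\infty)$ with $\lambda^{\min}\in\mathbb{R}^K$. Put $f(x,\lambda)=a(x)+\sum_{k=1}^K\lambda_kb_k(x)$. It is assumed that there are positive rationals $\mathrm{LB}\le\mathrm{UB}$ with $b_k(x),f(x,\lambda^{\min})\in\{0\}\cup[\mathrm{LB},\mathrm{UB}]$ for all $x\in X$ and $k=1,\dots,K$; hence $f(x,\lambda)\ge0$ for all $x\in X$, $\lambda\in\Lambda$. A finite set $S\subseteq X$ is a $\beta$-approximation set if for every $\lambda\in\Lambda$ there is $x\in S$ with $f(x,\lambda)\le\beta f(x',\lambda)$ for all $x'\in X$. $\mathrm{ALG}_1$ is an exact algorithm (oracle) for the non-parametric version: given $\lambda\in\Lambda$ it returns some solution $x\in X$ with $f(x,\lambda)\le f(x',\lambda)$ for all $x'\in X$. An algorithm ''generates feasible solutions only by calling $\mathrm{ALG}_1$'' if every solution in its output set $S$ has been returned by $\mathrm{ALG}_1$ for some $\lambda\in\Lambda$. *)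

(* Defs.v *)
From mathcomp Require Import all_boot all_order all_algebra.
From mathcomp Require Import finmap.
From mathcomp Require Import classical_sets reals.

Set Implicit Arguments.
Unset Strict Implicit.
Unset Printing Implicit Defensive.

Import Order.TTheory GRing.Theory Num.Theory.

Local Open Scope ring_scope.

(* The nonempty set X is the carrier [solution]. Asking for a choiceType only
   serves to have {fset X}: classically every type carries such a structure. *)
Record instance (R : realType) (K : nat) := Instance {
  solution : choiceType;
  solution_nonempty : inhabited solution;
  const_a : solution -> R;
  coef_b : 'I_K -> solution -> R;
  lambda_min : 'rV[R]_K;
  LB : rat;
  UB : rat;
  LB_gt0 : 0 < LB;
  LB_le_UB : LB <= UB;
  b_range : forall k x,
    coef_b k x = 0 \/ ratr LB <= coef_b k x <= ratr UB;
  f_min_range : forall x,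
    let v := const_a x + \sum_(k < K) lambda_min 0 k * coef_b k x in
    v = 0 \/ ratr LB <= v <= ratr UB
}.

Section Parametric.
Variables (R : realType) (K : nat).
Implicit Types (I : instance R K) (lam : 'rV[R]_K).

Definition objective I (x : solution I) lam : R :=
  const_a x + \sum_(k < K) lam 0 k * coef_b k x.

Definition Lambda I : set 'rV[R]_K :=
  [set lam | forall k, lambda_min I 0 k <= lam 0 k]%classic.

Definition optimal I lam (x : solution I) : Prop :=
  forall x' : solution I, objective x lam <= objective x' lam.

Definition approximation_set I (beta : R) (S : {fset solution I}) : Prop :=
  forall lam, Lambda I lam ->
    exists2 x, x \in S & forall x' : solution I, objective x lam <= beta * objective x' lam.

Definition min_approximation_set I (beta : R) (S : {fset solution I}) : Prop :=
  approximation_set beta S /\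
  forall S' : {fset solution I},
    approximation_set beta S' -> (#|` S| <= #|` S'|)%N.

(* Minima need not be attained when X is infinite; an exact algorithm can only
   exist for the instances in which they are. *)
Definition solvable I : Prop :=
  forall lam, Lambda I lam -> exists x : solution I, optimal lam x.

Definition oracle := forall I, 'rV[R]_K -> solution I.

Definition exact (ALG1 : oracle) : Prop :=
  forall I, solvable I -> forall lam, Lambda I lam -> optimal lam (ALG1 I lam).

(* A terminating computation on a given instance: it either stops with an
   output set or calls the oracle and continues depending on the answer.
   Nothing else about it is restricted (in particular, neither its internal
   computations nor its knowledge of the instance). *)
Inductive procedure (X : choiceType) : Type :=
| Output of {fset X}
| Call of 'rV[R]_K & (X -> procedure X).

Fixpoint output (X : choiceType) (alg1 : 'rV[R]_K -> X) (p : procedure X) :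
    {fset X} :=
  match p with
  | Output out => out
  | Call lam next => output alg1 (next (alg1 lam))
  end.

Fixpoint calls (X : choiceType) (alg1 : 'rV[R]_K -> X) (p : procedure X) :
    seq ('rV[R]_K * X) :=
  match p with
  | Output _ => [::]
  | Call lam next => (lam, alg1 lam) :: calls alg1 (next (alg1 lam))
  end.

Definition algorithm := forall I, procedure (solution I).

Definition generates_only_by_calling (ALG1 : oracle) (A : algorithm) I : Prop :=
  forall x, x \in output (ALG1 I) (A I) ->
    exists2 lam, Lambda I lam & (lam, x) \in calls (ALG1 I) (A I).

End Parametric.

(* Main.v *)
Require Import Defs.
From mathcomp Require Import all_boot all_order all_algebra.
From mathcomp Require Import finmap.
From mathcomp Require Import classical_sets reals.
From mathcomp Require Import ring lra.

(** Write [f(x, lam) = \sum_(j <= K) c_j(x) mu_j] with [mu_0 = 1] and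
    [mu_k = lam_k]. Take [K + 1] "extreme" solutions [x_i] with [c_i(x_i) = 1]
    and all other coefficients equal to [M = beta + (beta - 1) / (K + 1)], and
    one "central" solution with all coefficients equal to [beta].
    - The central solution alone is a [beta]-approximation set, as every
      extreme coefficient is at least [1].
    - It is never optimal, since the average of the extreme solutions has all
      coefficients [(1 + K M) / (K + 1) < beta]; hence no exact oracle ever
      returns it.
    - For [mu] close to the direction [e_i], any other extreme solution costs
      about [M > beta] times as much as [x_i], so every [x_i] is needed. *)

Set Implicit Arguments.
Unset Strict Implicit.
Unset Printing Implicit Defensive.

Import Order.TTheory GRing.Theory Num.Theory.

Local Open Scope ring_scope.

Lemma calls_answer (R : realType) (K : nat) (X : choiceType)
    (alg1 : 'rV[R]_K -> X) (p : procedure R K X) lam x :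
  (lam, x) \in calls alg1 p -> x = alg1 lam.
Proof.
elim: p => [//|mu next IH] /=; rewrite inE => /orP[/eqP[-> ->] //|].
exact: IH.
Qed.

Lemma solvable_finite (R : realType) (K : nat) (I : instance R K)
    (T : finType) (g : T -> solution I) :
  (forall x, exists t, g t = x) -> solvable I.
Proof.
move=> g_surj lam _; have [x0] := solution_nonempty I.
have [t0 _] := g_surj x0.
case: (@arg_minP _ _ _ t0 xpredT (fun t => objective (g t) lam)) => // t _ tmin.
by exists (g t) => x'; have [t' <-] := g_surj x'; exact: tmin.
Qed.

Section HomogeneousWeights.
Variables (R : realType) (K : nat).
Implicit Types (lam : 'rV[R]_K) (i j : 'I_K.+1).

Definition weight lam i : R := if unlift ord0 i is Some k then lam 0 k else 1.

Lemma weight0 lam : weight lam ord0 = 1.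
Proof. by rewrite /weight unlift_none. Qed.

Lemma weight_lift lam k : weight lam (lift ord0 k) = lam 0 k.
Proof. by rewrite /weight liftK. Qed.

Lemma sum_weight lam (c : 'I_K.+1 -> R) :
  c ord0 + \sum_(k < K) lam 0 k * c (lift ord0 k) = \sum_j weight lam j * c j.
Proof.
rewrite big_ord_recl weight0 mul1r; congr (_ + _).
by apply: eq_bigr => k _; rewrite weight_lift.
Qed.

Lemma weight_ge0 lam : (forall k, 0 <= lam 0 k) -> forall i, 0 <= weight lam i.
Proof. by move=> lam0 i; rewrite /weight; case: unlift. Qed.

Lemma total_weight_gt0 lam :
  (forall k, 0 <= lam 0 k) -> 0 < \sum_j weight lam j.
Proof.
move=> lam0; rewrite big_ord_recl weight0 ltr_pwDl // sumr_ge0 // => j _.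
exact: weight_ge0.
Qed.

(** Provides parameters arbitrarily close to the direction [e_i]. For [i = k + 1], taking
    [lam_k = C] and zeros elsewhere leaves only [mu_0 = 1] outside [i], and [C * 1 < 1 + C]. For
    [i = 0], [lam = 0] leaves nothing outside. *)
Lemma concentrated_weight i (C : R) : 0 <= C ->
  exists2 lam : 'rV[R]_K, forall k, 0 <= lam 0 k &
    C * (\sum_j weight lam j - weight lam i) < \sum_j weight lam j.
Proof.
move=> C0; case: (unliftP ord0 i) => [k ->|->].
- exists (\row_l (if l == k then C else 0)) => [l|].
    by rewrite mxE; case: ifP.
  rewrite big_ord_recl weight0 weight_lift mxE eqxx.
  have -> : \sum_(l < K) weight (\row_l (if l == k then C else 0)) (lift ord0 l)
            = C.
    rewrite (bigD1 k) //= weight_lift mxE eqxx big1 ?addr0 // => l /negPf lk.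
    by rewrite weight_lift mxE lk.
  lra.
- exists 0 => [l|]; first by rewrite mxE.
  rewrite big_ord_recl weight0 big1 => [|l _]; last by rewrite weight_lift mxE.
  lra.
Qed.

End HomogeneousWeights.

Section BadInstance.
Variables (R : realType) (K : nat) (beta : R).
Hypothesis beta_gt1 : 1 < beta.
Implicit Types (lam : 'rV[R]_K) (i j : 'I_K.+1).

(** Two constraints guide the choice: [gap > 0], so that [M > beta], and [K * gap < beta - 1], so
    that the average of the extreme solutions stays below [beta]. Dividing by [K + 1] rather than
    [K] makes the latter strict. *)
Let gap : R := (beta - 1) / K.+1%:R.
Let M : R := beta + gap.

Let gap_gt0 : 0 < gap.
Proof. by rewrite divr_gt0 ?ltr0n // subr_gt0. Qed.

(* [None] is the central solution, [Some i] are the extreme ones. *)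
Definition bad_coef (x : option 'I_K.+1) j : R :=
  if x is Some i then if j == i then 1 else M else beta.

(** [M] is real while an instance asks for a rational bound, hence the rounding up. *)
Definition bad_UB : rat := (Num.truncn M).+1%:R.

Lemma bad_LB_le_UB : 1 <= bad_UB.
Proof. by rewrite /bad_UB ler1n. Qed.

Lemma bad_coef_range x j : ratr 1 <= bad_coef x j <= ratr bad_UB.
Proof.
have M_lt : M < ratr bad_UB by rewrite ratr_nat; exact: truncnS_gt.
have := gap_gt0; have := beta_gt1; rewrite rmorph1 => b1 g0.
have ME : M = beta + gap by [].
by case: x => [i|] /=; [case: ifP => _|]; apply/andP; split; lra.
Qed.

Lemma bad_min_range x :
  let v := bad_coef x ord0
    + \sum_(k < K) (0 : 'rV[R]_K) 0 k * bad_coef x (lift ord0 k) in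
  v = 0 \/ ratr 1 <= v <= ratr bad_UB.
Proof.
rewrite big1 ?addr0 => [|k _]; last by rewrite mxE mul0r.
by right; exact: bad_coef_range.
Qed.

Definition bad_instance : instance R K :=
  @Instance R K (option 'I_K.+1) (inhabits None)
    (fun x => bad_coef x ord0) (fun k x => bad_coef x (lift ord0 k)) 0
    1 bad_UB ltr01 bad_LB_le_UB
    (fun k x => or_intror (bad_coef_range x (lift ord0 k))) bad_min_range.

Let central : solution bad_instance := None.
Let extreme i : solution bad_instance := Some i.

Lemma bad_Lambda lam : Lambda bad_instance lam <-> forall k, 0 <= lam 0 k.
Proof. by split=> lam0 k; have := lam0 k; rewrite /= mxE. Qed.

Lemma objective_central lam :
  objective central lam = beta * \sum_j weight lam j.
Proof.
by rewrite [LHS](sum_weight _ (bad_coef None)) -mulr_suml mulrC.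
Qed.

Lemma objective_extreme i lam :
  objective (extreme i) lam
    = M * (\sum_j weight lam j) - (M - 1) * weight lam i.
Proof.
rewrite [LHS](sum_weight _ (bad_coef (Some i))) (bigD1 i) //=.
rewrite [in RHS](bigD1 i) //= eqxx.
under eq_bigr => j /negPf ji do rewrite ji.
by rewrite -mulr_suml; ring.
Qed.

Lemma bad_solvable : solvable bad_instance.
Proof.
apply: (@solvable_finite _ _ bad_instance _ (id : option 'I_K.+1 -> _)) => x.
by exists x.
Qed.

Lemma central_not_optimal lam :
  Lambda bad_instance lam -> ~ optimal lam central.
Proof.
move=> /bad_Lambda lam0 opt.
have T0 := total_weight_gt0 lam0; set T := \sum_j _ in T0.
have : \sum_(i < K.+1) objective central lam
       <= \sum_(i < K.+1) objective (extreme i) lam.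
  by apply: ler_sum => i _; exact: opt.
under [X in _ <= X]eq_bigr => i _ do rewrite objective_extreme.
rewrite sumrB !sumr_const card_ord -mulr_sumr objective_central -/T.
rewrite -(mulr_natl (beta * T)) -(mulr_natl (M * T)) -subr_ge0.
(* With [T] the total weight, the summed inequality says that [((K + 1) * gap - (M - 1)) * T] is
   nonnegative, but this equals [- gap * T < 0]. *)
have gapE : K.+1%:R * gap = beta - 1 by rewrite mulrC divfK // pnatr_eq0.
have -> : K.+1%:R * (M * T) - (M - 1) * T - K.+1%:R * (beta * T)
    = (K.+1%:R * gap - (M - 1)) * T by rewrite /M; ring.
by rewrite gapE /M pmulr_lge0 //; have := gap_gt0; lra.
Qed.

Lemma central_approximation : approximation_set beta [fset central]%fset.
Proof.
move=> lam /bad_Lambda lam0; exists central; first by rewrite inE.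
have T0 := total_weight_gt0 lam0; have b1 := beta_gt1.
case=> [i|]; rewrite -?/(extreme i) -?/central objective_central.
  (* After cancelling [beta], the claim [T <= M T - (M - 1) mu_i] amounts to [mu_i <= T]. *)
  rewrite objective_extreme ler_pM2l; last lra.
  have wT : weight lam i <= \sum_j weight lam j.
    rewrite (bigD1 i) //= lerDl sumr_ge0 // => j _; exact: weight_ge0.
  have M1 : 0 <= M - 1 by rewrite /M; have := gap_gt0; lra.
  have := ler_wpM2l M1 wT; lra.
by rewrite ler_peMl ?ltW // mulr_gt0 //; lra.
Qed.

Lemma central_min_approximation :
  min_approximation_set beta [fset central]%fset.
Proof.
split=> [|S' S'P]; first exact: central_approximation.
(* [Lambda] contains [0], so an approximation set cannot be empty. *)
have [|x xS' _] := S'P 0; first by apply/bad_Lambda => k; rewrite mxE.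
by rewrite cardfs1 cardfs_gt0; apply/fset0Pn; exists x.
Qed.

Lemma extreme_needed i (S : {fset solution bad_instance}) :
  approximation_set beta S -> central \notin S -> extreme i \in S.
Proof.
move=> SP cS; have g0 := gap_gt0; have b1 := beta_gt1.
have M1 : 0 < M - 1 by rewrite /M; lra.
(* Put [d = T - mu_i]. If [x_j] with [j != i] served for [x_i], then [mu_j <= d] would give
   [M T - (M - 1) d <= beta (T + (M - 1) d)], that is [gap T <= (M - 1) (1 + beta) d]. This constant
   [C] with [C d < T] excludes that. *)
have C0 : 0 <= (M - 1) * (1 + beta) / gap.
  by rewrite divr_ge0 ?ltW // mulr_gt0 //; lra.
have [lam lam0] := concentrated_weight i C0.
rewrite mulrAC ltr_pdivrMr //.
have [|[j|] xS xP] := SP lam; first exact/bad_Lambda; last first.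
  by move: cS; rewrite xS.
have [<- //|ji] := eqVneq j i.
have := xP (extreme i); rewrite -/(extreme j) !objective_extreme.
have wji : weight lam j <= \sum_j weight lam j - weight lam i.
  rewrite (bigD1 i) //= addrAC subrr add0r (bigD1 j) //= lerDl sumr_ge0 // => l _.
  exact: weight_ge0.
have := ler_wpM2l (ltW M1) wji.
set T := \sum_j _; set r := weight lam i; set s := weight lam j => h1 h2 h3.
have gapE : gap = M - beta by rewrite /M; ring.
move: h1 h2 h3; rewrite gapE; move: M => m; lra.
Qed.

Lemma bad_card_ge (S : {fset solution bad_instance}) :
  approximation_set beta S -> central \notin S -> (K.+1 <= #|` S|)%N.
Proof.
move=> SP cS; rewrite -[K.+1]card_ord cardE -(size_map extreme).
apply: uniq_leq_size => [|_ /mapP[i _ ->]]; last exact: extreme_needed.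
by rewrite map_inj_uniq ?enum_uniq // => i j [].
Qed.

End BadInstance.

Theorem theorem3p2 (R : realType) (beta : R) (hbeta : 1 < beta)
    (K : nat) (hK : (1 <= K)%N)
    (ALG1 : oracle R K) (hALG1 : exact ALG1) :
  ~ exists A : algorithm R K,
      forall I : instance R K, solvable I ->
        let S := output (ALG1 I) (A I) in
        [/\ approximation_set beta S,
            forall Sstar : {fset solution I}, min_approximation_set beta Sstar ->
              (#|` S| < K.+1 * #|` Sstar|)%N
          & generates_only_by_calling ALG1 A I].
Proof.
move=> [A AP]; have solv := @bad_solvable _ K _ hbeta.
have [SP Scard Sgen] := AP _ solv.
have := Scard _ (@central_min_approximation _ K _ hbeta).
rewrite cardfs1 muln1 ltnNge bad_card_ge //.
(* If the output contained the central solution, that solution would be an oracle answer, hence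
   optimal for some parameter in [Lambda]. *)
apply/negP => /Sgen[lam lamL /calls_answer E].
by apply: (central_not_optimal lamL); rewrite E; exact: hALG1.
Qed.
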